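(* Let $n \geq 2$ be an integer, let $u > 0$ and $\beta \in \mathbb{R}$, and let $f : [0,\infty) \to [0,\infty)$ be given by $f(x) := (x+u)^{-\beta}$. Then the critical exponent of $f$ is $m(f,n) = n-2+\max(\beta,0)$. Moreover, there are only finitely many values $0 \leq \alpha < m(f,n)$ such that the map $g(x) = x^\alpha (x+u)^{-\beta}$ preserves $DN_n$ (that is, $g(A) \in DN_n$ for all $A \in DN_n$), and these values are contained in the set $\{m + \max(\beta,0) : m = 0, 1, \dots, n-3\}$ (which is empty if $n=2$).
   Context: A real symmetric $n \times n$ matrix is doubly nonnegative if it is both positive semidefinite and entrywise nonnegative; $DN_n$ denotes the set of all such matrices. For $h : [0,\infty) \to [0,\infty)$ and $A \in DN_n$ with spectral decomposition $A = U D U^T$ ($U$ real orthogonal, $D = \mathrm{diag}(d_{11},\dots,d_{nn})$), the matrix $h(A)$ is defined by $h(A) := U\,\mathrm{diag}(h(d_{11}),\dots,h(d_{nn}))\,U^T$. In particular $A^\alpha$ for real $\alpha \geq 0$ is $h(A)$ with $h(x) = x^\alpha$ (with $0^0 = 1$, so $A^0$ is the identity matrix), and $A^\alpha f(A)$ equals $g(A)$ for $g(x) = x^\alpha f(x)$. The critical exponent of $f : [0,\infty) \to [0,\infty)$ is $$m(f,n) := \inf\{\, t \in \mathbb{R},\ t \geq 0 \ : \ A^\alpha f(A) \in DN_n \text{ for all } A \in DN_n \text{ and all real } \alpha \geq t \,\}.$$ *)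

(* Defs.v *)
From mathcomp Require Import all_boot all_order all_algebra.
From mathcomp Require Import all_classical all_reals all_analysis.

Set Implicit Arguments.
Unset Strict Implicit.
Unset Printing Implicit Defensive.

Import Order.TTheory GRing.Theory Num.Theory.

Local Open Scope classical_set_scope.
Local Open Scope ring_scope.

Definition psdmx (R : realType) (n : nat) (A : 'M[R]_n) : Prop :=
  A^T = A /\ forall v : 'cV[R]_n, 0 <= (v^T *m A *m v) 0 0.

Definition doubly_nonneg (R : realType) (n : nat) (A : 'M[R]_n) : Prop :=
  psdmx A /\ forall i j, 0 <= A i j.

Definition spectral_decomposition (R : realType) (n : nat) (A : 'M[R]_n)
    (Ud : 'M[R]_n * 'rV[R]_n) : Prop :=
  Ud.1 *m Ud.1^T = 1%:M /\ A = Ud.1 *m diag_mx Ud.2 *m Ud.1^T.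

(* h(A), computed from a chosen spectral decomposition of A; the result does
   not depend on the choice (mxfunE). The default of xget is only used when A
   has no spectral decomposition, i.e. when A is not symmetric. A function on
   [0, oo) is represented by h : R -> R: the eigenvalues of a positive
   semidefinite A are nonnegative, so h is never applied outside [0, oo). *)
Definition mxfun (R : realType) (n : nat) (h : R -> R) (A : 'M[R]_n) : 'M[R]_n :=
  let Ud := xget (1%:M, 0) [set Ud | spectral_decomposition A Ud] in
  Ud.1 *m diag_mx (map_mx h Ud.2) *m Ud.1^T.

Lemma mxfunE (R : realType) (n : nat) (h : R -> R) (A : 'M[R]_n)
    (U : 'M[R]_n) (d : 'rV[R]_n) :
  spectral_decomposition A (U, d) ->
  mxfun h A = U *m diag_mx (map_mx h d) *m U^T.
Proof.
move=> AUd; rewrite /mxfun; case: xgetP => [[V e] _ /= AVe|/(_ (U, d))//].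
case: AUd AVe => /= UUT AU [/= VVT AV].
have UTU := mulmx1C UUT; have VTV := mulmx1C VVT.
pose W := V^T *m U.
have WdeW : W *m diag_mx d = diag_mx e *m W.
  have : V^T *m A *m U = V^T *m A *m U by [].
  by rewrite {1}AU {1}AV !mulmxA -(mulmxA _ U^T) UTU mulmx1 VTV mul1mx -!mulmxA.
have WheW : W *m diag_mx (map_mx h d) = diag_mx (map_mx h e) *m W.
  apply/matrixP => i j; move/matrixP/(_ i j): WdeW.
  rewrite !mul_mx_diag !mul_diag_mx !mxE.
  set w := (\sum_(k < n) _).
  have [->|w0] := eqVneq w 0; first by rewrite !mul0r !mulr0.
  by move/eqP; rewrite [eqbRHS]mulrC => /eqP /(mulfI w0) ->; rewrite mulrC.
have : V *m (W *m diag_mx (map_mx h d)) *m U^T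
     = V *m (diag_mx (map_mx h e) *m W) *m U^T by rewrite WheW.
by rewrite /W !mulmxA VVT mul1mx -[X in _ = X]mulmxA UUT mulmx1.
Qed.

Definition preserves_DN (R : realType) (n : nat) (g : R -> R) : Prop :=
  forall A : 'M[R]_n, doubly_nonneg A -> doubly_nonneg (mxfun g A).

(* The infimum is taken in the extended reals, so that it is +oo (rather than
   a default real number) if no exponent t is admissible. *)
Definition critical_exponent (R : realType) (f : R -> R) (n : nat) : \bar R :=
  ereal_inf [set t%:E | t in [set t : R | 0 <= t /\
    forall (A : 'M[R]_n) (alpha : R), doubly_nonneg A -> t <= alpha ->
      doubly_nonneg (mxfun (fun x => x `^ alpha) A *m mxfun f A)]].

(* Main.v *)
Require Import Defs.
From mathcomp Require Import all_boot all_order all_algebra.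
From mathcomp Require Import all_classical all_reals all_analysis.
From mathcomp Require Import perm complex ring lra zify.

(** Put [g x = x^p (x + u)^q] with [p = alpha], [q = - beta], and let [gamma]
    be the smaller of [p] and [p + q], that is [alpha - max(beta, 0)]. Both
    directions rest on one computation: for [x > 0] the [k]-th derivative of
    [g] is
      [x^(p-k) (x+u)^(q-k) * sum_i C(k,i) (p)_{k-i} (p+q-k+i)_i x^i u^(k-i)]
    with falling factorials [(z)_i] ([is_derive_iter_deriv]). If
    [gamma >= n - 2], every coefficient is nonnegative for [k <= n - 1]. If
    [(gamma)_k < 0], the derivative is negative somewhere: near [0] when
    [gamma = p], near infinity when [gamma = p + q]. A [k] with
    [1 <= k <= n - 1] and [(gamma)_k < 0] exists as soon as [gamma < n - 2] is
    not one of [0, ..., n - 3] ([falling_lt0]).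

    Why nonnegative derivatives suffice. Let [A] be symmetric with nonnegative
    off-diagonal entries and eigenvalues [r_0 <= ... <= r_(n-1)]. Newton
    interpolation of [g] at the eigenvalues gives
      [g(A) = sum_k c_k (A - r_0) ... (A - r_(k-1))],
    where the divided difference [c_k] equals [g^(k)(xi) / k!] by Rolle's
    theorem. The products [(A - r_0) ... (A - r_(k-1))] are entrywise
    nonnegative: this is the theorem of Micchelli and Willoughby
    ([micchelli_willoughby]). Its proof is an induction on the size. The
    products are the coefficients of the adjugate of [X - A] in the Newton
    basis attached to the eigenvalues in decreasing order; deleting one index
    expresses the entries of that adjugate, with nonnegative coefficients, by
    those of the adjugate of a principal submatrix; and Cauchy interlacing says
    that passing from the eigenvalues of the submatrix to those of [A] keeps
    Newton coefficients nonnegative. Repeated eigenvalues are handled by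
    interpolating at the separated nodes [r_i + (i + 1) e] and letting [e] tend
    to [0] ([orth_diag_map_ge0]).

    Why a negative derivative is fatal. If [g^(k)(c) < 0] and [k <= n - 1], let
    [A = c + t B] with [B] the adjacency matrix of the path on [k + 1]
    vertices and [t > 0] small. No power of [A] below the [k]-th links the two
    ends of the path, so the corresponding entry of [g(A)] is [c_k t^k], where
    [c_k] is a divided difference of [g] at points close to [c]; it is
    negative ([neg_deriv_not_preserves_DN]). A block of zeros brings the matrix
    to size [n]. *)

Set Implicit Arguments.
Unset Strict Implicit.
Unset Printing Implicit Defensive.

Import Order.TTheory GRing.Theory Num.Theory.
Import numFieldNormedType.Exports.

Local Open Scope classical_set_scope.
Local Open Scope ring_scope.

(** * Spectral theorem for real symmetric matrices *)

Lemma dotmx_ge0 (R : realDomainType) n (v : 'rV[R]_n) : 0 <= (v *m v^T) 0 0.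
Proof. by rewrite mxE; apply: sumr_ge0 => k _; rewrite mxE -expr2 sqr_ge0. Qed.

Lemma dotmx_gt0 (R : realDomainType) n (v : 'rV[R]_n) :
  v != 0 -> 0 < (v *m v^T) 0 0.
Proof.
move=> v0; rewrite lt_def dotmx_ge0 andbT; apply: contraNN v0.
rewrite mxE psumr_eq0 => [/allP v0|k _]; last by rewrite mxE -expr2 sqr_ge0.
apply/eqP/rowP => k; have := v0 k (mem_index_enum k).
by rewrite !mxE mulf_eq0 orbb => /eqP.
Qed.

Lemma dotmx_eq0 (R : realDomainType) n (v : 'rV[R]_n) :
  (v *m v^T) 0 0 = 0 -> v = 0.
Proof. by apply: contra_eq => /dotmx_gt0 /lt0r_neq0. Qed.

Lemma trmx11 (R : nzRingType) (M : 'M[R]_1) : M^T = M.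
Proof. by apply/matrixP => i j; rewrite !ord1 mxE. Qed.

(** A complex eigenvector [x + i y] exists. Comparing [x A y^T] with [y A x^T]
    shows that the imaginary part of its eigenvalue vanishes, so that [x] and
    [y], one of which is nonzero, are real eigenvectors. *)
Lemma symmetric_eigenvalue (R : rcfType) n (A : 'M[R]_n.+1) :
  A^T = A -> exists2 v : 'rV[R]_n.+1, v != 0 & exists r, v *m A = r *: v.
Proof.
move=> Asym; pose C := complex R : numClosedFieldType.
pose AC : 'M[C]_n.+1 := map_mx (real_complex R) A.
have [z /eigenvalueP[w wA w0]] := eigenvalue_closed AC isT.
pose x := map_mx (@complex.Re R) w; pose y := map_mx (@complex.Im R) w.
pose a := complex.Re z; pose b := complex.Im z.
have ReD : {morph @complex.Re R : u v / u + v} by case=> ? ? [? ?].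
have ImD : {morph @complex.Im R : u v / u + v} by case=> ? ? [? ?].
have xA : x *m A = a *: x - b *: y.
  apply/rowP => j; have := congr1 (fun B : 'rV_n.+1 => complex.Re (B 0 j)) wA.
  rewrite !mxE (big_morph _ ReD erefl) => /= E.
  transitivity (complex.Re (z * w 0 j)); last first.
    by rewrite /a /b; case: z {wA a b E} => ? ?; case: (w 0 j).
  rewrite -E; apply: eq_bigr => k _; rewrite !mxE; case: (w 0 k) => ? ? /=.
  by rewrite mulr0 subr0.
have yA : y *m A = a *: y + b *: x.
  apply/rowP => j; have := congr1 (fun B : 'rV_n.+1 => complex.Im (B 0 j)) wA.
  rewrite !mxE (big_morph _ ImD erefl) => /= E.
  transitivity (complex.Im (z * w 0 j)); last first.
    by rewrite /a /b; case: z {wA a b xA E} => ? ?; case: (w 0 j).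
  rewrite -E; apply: eq_bigr => k _; rewrite !mxE; case: (w 0 k) => ? ? /=.
  by rewrite mulr0 add0r.
have xAy : (x *m A *m y^T) 0 0 = (y *m A *m x^T) 0 0.
  by rewrite -(trmx11 (y *m A *m x^T)) !trmx_mul trmxK Asym mulmxA.
have b0 : b = 0.
  move: xAy; rewrite xA yA !mulmxDl mulNmx -!scalemxAl.
  rewrite -(trmx11 (x *m y^T)) trmx_mul trmxK.
  rewrite !mxE => /addrI /eqP; rewrite eq_sym -subr_eq0 opprK -mulrDr mulf_eq0.
  case/orP => [/eqP //|]; rewrite paddr_eq0; last 2 first.
    by have := dotmx_ge0 x; rewrite mxE.
    by have := dotmx_ge0 y; rewrite mxE.
  case/andP => x0 y0; case/eqP: w0; apply/rowP => k.
  have /rowP/(_ k) xk : x = 0.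
    by apply: dotmx_eq0; rewrite mxE; exact/eqP.
  have /rowP/(_ k) yk : y = 0.
    by apply: dotmx_eq0; rewrite mxE; exact/eqP.
  by move: xk yk; rewrite !mxE; case: (w 0 k) => ? ? /= -> ->.
have [x0|x0] := eqVneq x 0; last first.
  by exists x => //; exists a; rewrite xA b0 scale0r subr0.
exists y; last by exists a; rewrite yA b0 scale0r addr0.
apply: contraNneq w0 => y0; apply/eqP/rowP => k.
move/rowP/(_ k): x0; move/rowP/(_ k): y0; rewrite !mxE.
by case: (w 0 k) => ? ? /= -> ->.
Qed.

(** The reflection exchanging [v] with the first basis vector. *)
Lemma householder (R : rcfType) n (v : 'rV[R]_n.+1) : v *m v^T = 1%:M ->
  exists2 H : 'M[R]_n.+1, H *m H^T = 1%:M & row 0 H = v.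
Proof.
move=> vv; pose e : 'rV[R]_n.+1 := delta_mx 0 0; pose w := v - e.
have [w0|w0] := eqVneq w 0.
  exists 1%:M; first by rewrite trmx1 mulmx1.
  by move/eqP: w0; rewrite subr_eq0 => /eqP ->; rewrite row1.
have ww0 := lt0r_neq0 (dotmx_gt0 w0).
set q := (w *m w^T) 0 0 in ww0.
have eE (u : 'cV[R]_n.+1) : e *m u = row 0 u by rewrite rowE.
have wwq : w *m w^T = q%:M by rewrite [LHS]mx11_scalar.
pose H := 1%:M - (2 / q) *: (w^T *m w).
have HT : H^T = H by rewrite /H linearB /= linearZ /= trmx_mul trmxK trmx1.
have vv00 : \sum_j v 0 j * v^T j 0 = 1 by move/matrixP/(_ 0 0): vv; rewrite !mxE.
have qE : q = 2 - 2 * v 0 0.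
  rewrite /q /w linearB /= mulmxBl !mulmxBr vv.
  rewrite -[v *m e^T]trmx11 trmx_mul trmxK !eE !mxE !eqxx /=; ring.
exists H; last first.
  rewrite rowE -/e /H mulmxBr mulmx1 -scalemxAr mulmxA.
  rewrite [e *m w^T]mx11_scalar eE !mxE eqxx mul_scalar_mx scalerA /=.
  have -> : 2 / q * (v 0 0 - 1) = -1.
    apply: (mulIf ww0); rewrite mulrAC mulfVK // qE; ring.
  by rewrite scaleN1r opprK addrC subrK.
have PP : w^T *m w *m (w^T *m w) = q *: (w^T *m w).
  by rewrite -mulmxA (mulmxA w) wwq mul_scalar_mx -scalemxAr.
rewrite HT /H; move: (w^T *m w) PP => P PP.
rewrite mulmxBl mul1mx mulmxBr mulmx1 -scalemxAl -scalemxAr PP !scalerA.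
have -> : 2 / q * (2 / q) * q = 2 / q * 2 by rewrite -mulrA mulfVK.
apply/matrixP => i j; rewrite !mxE; ring.
Qed.

(** A reflection sending the first basis vector to a unit eigenvector splits off
    a [1 x 1] block; symmetry clears the rest of the first column. *)
Lemma orth_diag (R : rcfType) n (A : 'M[R]_n) : A^T = A ->
  exists U : 'M[R]_n, exists d : 'rV[R]_n,
    U *m U^T = 1%:M /\ A = U *m diag_mx d *m U^T.
Proof.
elim: n A => [|n IH] A Asym.
  exists 1%:M, 0; split; first by rewrite trmx1 mulmx1.
  by apply/matrixP => -[].
have [v0 v0n0 [r v0A]] := symmetric_eigenvalue Asym.
pose nv := Num.sqrt ((v0 *m v0^T) 0 0); have nv0 : 0 < nv by rewrite sqrtr_gt0 dotmx_gt0.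
pose v := nv^-1 *: v0.
have vA : v *m A = r *: v by rewrite -scalemxAl v0A scalerA mulrC -scalerA.
have vv : v *m v^T = 1%:M.
  rewrite [LHS]mx11_scalar /v linearZ /= -scalemxAl -scalemxAr scalerA mxE.
  rewrite -[X in _ * X]sqr_sqrtr ?dotmx_ge0 // -/nv; congr (_%:M).
  by rewrite -expr2 -exprMn mulVf ?expr1n // gt_eqF.
have [H HH Hv] := householder vv; have HTH := mulmx1C HH.
pose B := H *m A *m H^T.
have BT : B^T = B by rewrite /B !trmx_mul trmxK Asym mulmxA.
have B0 : row 0 B = r *: delta_mx 0 0.
  rewrite /B !row_mul Hv vA -scalemxAl -Hv -row_mul HH; congr (_ *: _).
  exact: row1.
pose B' : 'M[R]_(1 + n) := B.
have l0 : lshift n (0 : 'I_1) = (0 : 'I_n.+1) by exact/val_inj.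
have BE : B' = block_mx r%:M 0 0 (drsubmx B').
  rewrite -[LHS]submxK; congr block_mx.
  - apply/matrixP => i j; rewrite !ord1; move/rowP/(_ 0): B0.
    by rewrite !mxE l0 eqxx mulr1.
  - apply/matrixP => i j; rewrite !ord1; move/rowP/(_ (rshift 1 j)): B0.
    by rewrite !mxE l0 mulr0.
  - apply/matrixP => i j; rewrite !ord1; move/rowP/(_ (rshift 1 i)): B0.
    have /matrixP/(_ (rshift 1 i) 0) := BT; rewrite {}/B'; move: B {BT} => B BT.
    by move: (BT); rewrite !mxE l0 mulr0 => <-.
have [|U' [d' [UU' dE]]] := IH (drsubmx B').
  by rewrite trmx_drsub /B' BT.
pose W : 'M[R]_(1 + n) := block_mx 1%:M 0 0 U'.
pose d : 'rV[R]_(1 + n) := row_mx r%:M d'.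
have WW : W *m W^T = 1%:M.
  rewrite /W tr_block_mx mulmx_block !trmx0 trmx1.
  by rewrite !(mulmx0, mul0mx, mulmx1, addr0, add0r) UU' scalar_mx_block.
have BW : B' = W *m diag_mx d *m W^T.
  rewrite BE /W diag_mx_row tr_block_mx !mulmx_block !trmx0 trmx1.
  rewrite !(mulmx0, mul0mx, mulmx1, mul1mx, addr0, add0r) -dE.
  by congr block_mx; apply/matrixP => i j; rewrite !ord1 !mxE eqxx.
exists (H^T *m W), d; split.
  by rewrite trmx_mul trmxK mulmxA -(mulmxA _ W) WW mulmx1 HTH.
rewrite trmx_mul trmxK !mulmxA -(mulmxA H^T) -(mulmxA H^T) -BW /B' /B.
by rewrite !mulmxA HTH mul1mx -mulmxA HTH mulmx1.
Qed.

Lemma orth_diagE (R : pzRingType) n (U : 'M[R]_n) (d : 'rV[R]_n) a b :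
  (U *m diag_mx d *m U^T) a b = \sum_k U a k * d 0 k * U b k.
Proof. by rewrite mul_mx_diag mxE; apply: eq_bigr => k _; rewrite !mxE. Qed.

(** The eigenvalues are given as a function on [nat], which is what Newton
    interpolation and the comparison of spectra of different sizes need. *)
Lemma orth_diag_sorted (R : rcfType) n (A : 'M[R]_n) : A^T = A ->
  exists (U : 'M[R]_n) (s : nat -> R),
    [/\ U *m U^T = 1%:M, A = U *m diag_mx (\row_i s i) *m U^T &
        (forall i j, (i <= j < n)%N -> s j <= s i)].
Proof.
move=> /orth_diag[V [d [VV AE]]].
pose t := [tuple d 0 i | i < n] : n.-tuple R; pose t' := sort >=%R t.
have szt' : size t' = n by rewrite size_sort size_tuple.
have [p t'E] : exists p : {perm 'I_n}, t' = [tuple tnth t (p i) | i < n] :> seq R.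
  by apply/tuple_permP; rewrite perm_sort.
have t'n (i : 'I_n) : nth 0 t' i = d 0 (p i).
  by rewrite t'E -tnth_nth !tnth_mktuple.
exists (col_perm p V), (nth 0 t'); split.
- rewrite -VV; apply/matrixP => a b; rewrite !mxE [RHS](reindex_inj (@perm_inj _ p)).
  by apply: eq_bigr => k _; rewrite !mxE.
- rewrite AE; apply/matrixP => a b.
  rewrite !orth_diagE (reindex_inj (@perm_inj _ p)).
  by apply: eq_bigr => k _; rewrite !mxE t'n.
- move=> i j /andP[ij jn].
  have st' : sorted >=%R t'.
    by apply: sort_sorted => x y; rewrite orbC; exact: le_total.
  have ge_tr : transitive (>=%R : rel R) by move=> x y z /= xy yz; exact: le_trans yz xy.
  have ge_refl : reflexive (>=%R : rel R) by move=> x /=.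
  have i_n := leq_ltn_trans ij jn.
  by apply: (sorted_leq_nth ge_tr ge_refl) st' _ _ _ _ ij; rewrite inE szt'.
Qed.

(** * Interlacing of eigenvalues *)

Section Forms.
Variables (R : realDomainType) (n : nat) (U : 'M[R]_n) (d : 'rV[R]_n).
Hypothesis UU : U *m U^T = 1%:M.

Lemma quad_formE (v : 'rV[R]_n) :
  (v *m (U *m diag_mx d *m U^T) *m v^T) 0 0 = \sum_k d 0 k * (v *m U) 0 k ^+ 2.
Proof.
rewrite !mulmxA -(mulmxA _ U^T) -trmx_mul; move: (v *m U) => z.
rewrite mul_mx_diag mxE.
by apply: eq_bigr => k _; rewrite !mxE mulrAC mulrC -expr2.
Qed.

Lemma norm_formE (v : 'rV[R]_n) : (v *m v^T) 0 0 = \sum_k (v *m U) 0 k ^+ 2.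
Proof.
rewrite -{1}[v]mulmx1 -UU mulmxA -mulmxA -trmx_mul; move: (v *m U) => z.
rewrite mxE.
by apply: eq_bigr => k _; rewrite !mxE -expr2.
Qed.

Lemma quad_form_ge (x : R) (v : 'rV[R]_n) :
  (forall k, (v *m U) 0 k != 0 -> x <= d 0 k) ->
  x * (v *m v^T) 0 0 <= (v *m (U *m diag_mx d *m U^T) *m v^T) 0 0.
Proof.
move=> xd; rewrite quad_formE norm_formE mulr_sumr; apply: ler_sum => k _.
have [->|/xd xk] := eqVneq ((v *m U) 0 k) 0; first by rewrite expr0n !mulr0.
by rewrite ler_wpM2r ?sqr_ge0.
Qed.

Lemma quad_form_le (x : R) (v : 'rV[R]_n) :
  (forall k, (v *m U) 0 k != 0 -> d 0 k <= x) ->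
  (v *m (U *m diag_mx d *m U^T) *m v^T) 0 0 <= x * (v *m v^T) 0 0.
Proof.
move=> xd; rewrite quad_formE norm_formE mulr_sumr; apply: ler_sum => k _.
have [->|/xd xk] := eqVneq ((v *m U) 0 k) 0; first by rewrite expr0n !mulr0.
by rewrite ler_wpM2r ?sqr_ge0.
Qed.
End Forms.

(** One half of Cauchy interlacing. The span of the eigenvectors of the
    submatrix for [m 0, ..., m l] has dimension [l + 1], so it contains a vector
    orthogonal to the eigenvectors of [A] for [s 0, ..., s (l - 1)]. On that
    vector the quadratic form of [A] is at least [m l] and at most [s l] times
    the squared norm. *)
Lemma eigenvalue_interlacing (R : realFieldType) n (A : 'M[R]_n.+1) (i : 'I_n.+1)
    (U : 'M[R]_n.+1) (V : 'M[R]_n) (s m : nat -> R) (l : nat) :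
  U *m U^T = 1%:M -> A = U *m diag_mx (\row_k s k) *m U^T ->
  (forall j k, (j <= k < n.+1)%N -> s k <= s j) ->
  V *m V^T = 1%:M -> row' i (col' i A) = V *m diag_mx (\row_k m k) *m V^T ->
  (forall j k, (j <= k < n)%N -> m k <= m j) ->
  (l < n)%N -> m l <= s l.
Proof.
move=> UU AE sdec VV BE mdec ln; have VTV := mulmx1C VV.
(* Rows: the first l + 1 eigenvectors of the submatrix. *)
pose X := rowsub (widen_ord ln) V^T.
(* E extends a row vector by a zero at index i. *)
pose E : 'M[R]_(n, n.+1) := \matrix_(a, b) (b == lift i a)%:R.
have ln1 : (l <= n.+1)%N by exact: leq_trans (ltnW ln) _.
(* Columns: the first l eigenvectors of A. *)
pose C := colsub (widen_ord ln1) U.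
have EE (p : nat) (M : 'M[R]_(n.+1, p)) a b : (E *m M) a b = M (lift i a) b.
  rewrite mxE (bigD1 (lift i a)) //= mxE eqxx mul1r big1 ?addr0 // => k /negPf kn.
  by rewrite mxE kn mul0r.
have EET : E *m E^T = 1%:M.
  by apply/matrixP => a b; rewrite EE !mxE (inj_eq lift_inj).
have EAE : E *m A *m E^T = row' i (col' i A).
  apply/matrixP => a b; rewrite -mulmxA EE -[_ *m _]trmxK mxE trmx_mul trmxK EE.
  by rewrite !mxE.
have [c c0 cM] : exists2 c : 'rV_l.+1, c != 0 & c *m (X *m E *m C) = 0.
  have : kermx (X *m E *m C) != 0.
    rewrite -mxrank_eq0 mxrank_ker -lt0n subn_gt0 ltnS; exact: rank_leq_col.
  by case/rowV0Pn => c /sub_kermxP cM c0; exists c.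
pose w := c *m X; pose v := w *m E.
have wV k : (w *m V) 0 k != 0 -> (k <= l)%N.
  apply: contraR; rewrite -ltnNge => lk.
  rewrite /w -mulmxA mul_rowsub_mx VTV mxE big1 // => a _.
  rewrite !mxE (_ : (_ == k) = false) ?mulr0 //.
  by apply/negbTE; rewrite -val_eqE /= neq_ltn (leq_trans _ lk) // ltnS -ltnS.
have vU k : (v *m U) 0 k != 0 -> (l <= k)%N.
  apply: contraR; rewrite -ltnNge => kl.
  have -> : k = widen_ord ln1 (Ordinal kl) by exact/val_inj.
  move/rowP/(_ (Ordinal kl)): cM.
  by rewrite !mulmxA -/w -/v mulmx_colsub [LHS]mxE [RHS]mxE => ->.
have vv : (v *m v^T) 0 0 = (w *m w^T) 0 0.
  by rewrite /v trmx_mul mulmxA -(mulmxA w) EET mulmx1.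
have w_gt0 : 0 < (w *m w^T) 0 0.
  have -> : w *m w^T = c *m c^T; last exact: dotmx_gt0.
  rewrite /w trmx_mul mulmxA -(mulmxA c) (_ : X *m X^T = 1%:M) ?mulmx1 //.
  rewrite /X trmx_mxsub trmxK -mxsub_mul VTV; apply/matrixP => a b.
  by rewrite !mxE -val_eqE.
have lo := quad_form_ge (d := \row_k m k) (x := m l) VV (v := w).
have hi := quad_form_le (d := \row_k s k) (x := s l) UU (v := v).
rewrite -(ler_pM2r w_gt0); apply: le_trans (lo _) _.
  by move=> k /wV kl; rewrite mxE mdec ?kl.
rewrite -vv; apply: le_trans (hi _); last first.
  by move=> k /vU kl; rewrite mxE sdec ?kl /=.
by rewrite -AE -BE -EAE /v (trmx_mul w) !mulmxA.
Qed.

(** * Newton cones and the Micchelli-Willoughby theorem *)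

Definition newton_basis (R : nzRingType) (s : nat -> R) (j : nat) : {poly R} :=
  \prod_(i < j) ('X - (s i)%:P).

(** The sum stops at degree [n - 1], the degree of the entries of the adjugate of
    [X - A] for [A] of size [n]. *)
Definition newton_cone (R : realFieldType) (s : nat -> R) (n : nat) (p : {poly R}) :=
  exists2 c : nat -> R, (forall j, 0 <= c j) &
    p = \sum_(j < n) c j *: newton_basis s j.

Section Cone.
Variable R : realFieldType.
Implicit Types (s t : nat -> R) (n j : nat) (p q : {poly R}).

Lemma newton_basisS s j : newton_basis s j.+1 = newton_basis s j * ('X - (s j)%:P).
Proof. by rewrite /newton_basis big_ord_recr. Qed.

Lemma size_newton_basis s j : size (newton_basis s j) = j.+1.
Proof. by rewrite size_prod_XsubC /index_enum -enumT size_enum_ord. Qed.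

Lemma newton_basis_monic s j : newton_basis s j \is monic.
Proof. exact: monic_prod_XsubC. Qed.

Lemma newton_basis_free s n (c : nat -> R) :
  \sum_(j < n) c j *: newton_basis s j = 0 -> forall j, (j < n)%N -> c j = 0.
Proof.
elim: n => [//|n IH]; rewrite big_ord_recr /= => cN.
have cn0 : c n = 0.
  move/(congr1 (fun p : {poly R} => p`_n)): cN; rewrite coefD coefZ coef0.
  have := newton_basis_monic s n; rewrite monicE lead_coefE size_newton_basis /=.
  move=> /eqP ->; rewrite mulr1 coef_sum big1 ?add0r // => i _.
  by rewrite coefZ nth_default ?mulr0 // size_newton_basis.
move: cN; rewrite cn0 scale0r addr0 => /IH c0 j.
by rewrite ltnS leq_eqVlt => /predU1P[->//|/c0].
Qed.

Lemma newton_cone0 s n : newton_cone s n 0.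
Proof. by exists (fun=> 0) => //; rewrite big1 // => i _; rewrite scale0r. Qed.

Lemma newton_coneD s n p q :
  newton_cone s n p -> newton_cone s n q -> newton_cone s n (p + q).
Proof.
move=> [c c0 ->] [d d0 ->]; exists (fun j => c j + d j).
  by move=> j; rewrite addr_ge0.
by rewrite -big_split; apply: eq_bigr => j _; rewrite scalerDl.
Qed.

Lemma newton_coneZ s n a p : 0 <= a -> newton_cone s n p -> newton_cone s n (a *: p).
Proof.
move=> a0 [c c0 ->]; exists (fun j => a * c j).
  by move=> j; rewrite mulr_ge0.
by rewrite scaler_sumr; apply: eq_bigr => j _; rewrite scalerA.
Qed.

Lemma newton_cone_sum s n (I : finType) (F : I -> {poly R}) :
  (forall i, newton_cone s n (F i)) -> newton_cone s n (\sum_i F i).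
Proof.
by move=> sF; apply: big_ind; [exact: newton_cone0|exact: newton_coneD|].
Qed.

Lemma newton_cone_basis s n j : (j < n)%N -> newton_cone s n (newton_basis s j).
Proof.
move=> jn; exists (fun i => (i == j)%:R) => [i|]; first exact: ler0n.
rewrite (bigD1 (Ordinal jn)) //= eqxx scale1r big1 ?addr0 // => i.
by rewrite -val_eqE /= => /negPf ->; rewrite scale0r.
Qed.

(** Multiply the factors [X - s_0], ..., [X - s_(j-1)] one at a time, using
      [(X - s_j) N_i = N_(i+1) + (t_i - s_j) N_i]
    where [N] is the basis of [t] and [i <= j]: the last coefficient is
    nonnegative because [t] decreases and dominates [s]. *)
Lemma newton_basis_cone s t n j :
  (forall i k, (i <= k < n)%N -> t k <= t i) ->
  (forall i, (i < n)%N -> s i <= t i) ->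
  (j <= n)%N -> newton_cone t j.+1 (newton_basis s j).
Proof.
move=> tdec st; elim: j => [_|j IH jn].
  have -> : newton_basis s 0 = newton_basis t 0 by rewrite /newton_basis !big_ord0.
  exact: newton_cone_basis.
have [c c0 cE] := IH (ltnW jn); rewrite newton_basisS cE mulr_suml.
apply: newton_cone_sum => i; rewrite -scalerAl; apply: newton_coneZ => //.
have -> : newton_basis t i * ('X - (s j)%:P) =
    newton_basis t i.+1 + (t i - s j) *: newton_basis t i.
  rewrite newton_basisS -mul_polyC polyCB; ring.
apply: newton_coneD; first by apply: newton_cone_basis; rewrite ltnS.
apply: newton_coneZ; last by apply: newton_cone_basis; rewrite ltnS ltnW.
have ij : (i <= j)%N by rewrite -ltnS.
by rewrite subr_ge0 (le_trans (st _ jn)) // tdec // ij.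
Qed.

Lemma newton_cone_widen s m n p : (m <= n)%N -> newton_cone s m p -> newton_cone s n p.
Proof.
move=> mn [c c0 ->]; apply: newton_cone_sum => i; apply: newton_coneZ => //.
by apply: newton_cone_basis; exact: leq_trans mn.
Qed.

Lemma newton_coneW s t n p :
  (forall i k, (i <= k < n)%N -> t k <= t i) ->
  (forall i, (i < n)%N -> s i <= t i) ->
  newton_cone s n p -> newton_cone t n p.
Proof.
move=> tdec st [c c0 ->]; apply: newton_cone_sum => j; apply: newton_coneZ => //.
apply: (@newton_cone_widen _ j.+1) => //.
exact: newton_basis_cone tdec st (ltnW (ltn_ord j)).
Qed.
End Cone.

Section Adjugate.
Variable R : rcfType.

Lemma char_poly_orth_diag n (U : 'M[R]_n) (d : 'rV[R]_n) :
  U *m U^T = 1%:M ->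
  char_poly (U *m diag_mx d *m U^T) = \prod_i ('X - (d 0 i)%:P).
Proof.
move=> UU; rewrite /char_poly.
pose UC := map_mx polyC U.
have UUC : UC *m UC^T = 1%:M by rewrite /UC map_trmx -map_mxM UU map_mx1.
have -> : char_poly_mx (U *m diag_mx d *m U^T) =
    UC *m diag_mx (\row_i ('X - (d 0 i)%:P)) *m UC^T.
  have -> : diag_mx (\row_i ('X - (d 0 i)%:P)) = 'X%:M - map_mx polyC (diag_mx d).
    apply/matrixP => i j; rewrite !mxE raddfMn /=.
    by case: eqP => _; rewrite ?mulr1n // !mulr0n subr0.
  rewrite mulmxBr mulmxBl /char_poly_mx !map_mxM -map_trmx -/UC; congr (_ - _).
  by rewrite mul_mx_scalar -scalemxAl UUC scalemx1.
rewrite !det_mulmx mulrAC -det_mulmx UUC det1 mul1r det_diag.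
by apply: eq_bigr => i _; rewrite mxE.
Qed.

Lemma char_poly_mx_minor n (A : 'M[R]_n.+1) i :
  row' i (col' i (char_poly_mx A)) = char_poly_mx (row' i (col' i A)).
Proof. by apply/matrixP => a b; rewrite !mxE (inj_eq lift_inj). Qed.

Lemma adjugate_diag n (A : 'M[R]_n.+1) i :
  (\adj (char_poly_mx A)) i i = char_poly (row' i (col' i A)).
Proof.
by rewrite mxE /cofactor char_poly_mx_minor exprD -expr2 sqrr_sign mul1r.
Qed.

(** The rows other than [i] of [(X - A) adj(X - A) = det(X - A)] form a linear
    system for column [i] of the adjugate, whose matrix is that of the principal
    submatrix; Cramer's rule solves it up to the factor [char_poly B], which
    cancels. *)
Lemma adjugate_offdiag n (A : 'M[R]_n.+1) i a :
  (\adj (char_poly_mx A)) (lift i a) i =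
  \sum_l A (lift i l) i *: (\adj (char_poly_mx (row' i (col' i A)))) a l.
Proof.
set B := row' i (col' i A); set M := char_poly_mx A.
pose v : 'cV_n := \col_k (\adj M) (lift i k) i.
pose w : 'cV_n := \col_l (A (lift i l) i)%:P.
have Mv : char_poly_mx B *m v = char_poly B *: w.
  apply/colP => l; have /matrixP/(_ (lift i l) i) := mul_mx_adj M.
  rewrite [RHS]mxE eq_sym (negPf (neq_lift _ _)) mulr0n mxE (bigD1_ord i) //=.
  rewrite adjugate_diag -/B => /eqP; rewrite addr_eq0 => /eqP E.
  rewrite ![in RHS]mxE mulrC; apply: oppr_inj.
  rewrite -mulNr [in RHS](_ : - _ = M (lift i l) i); last first.
    by rewrite !mxE eq_sym (negPf (neq_lift _ _)) mulr0n sub0r.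
  rewrite E; congr (- _); rewrite mxE; apply: eq_bigr => k _.
  by rewrite -char_poly_mx_minor !mxE.
have := congr1 (mulmx (\adj (char_poly_mx B))) Mv.
rewrite mulmxA mul_adj_mx mul_scalar_mx -scalemxAr -/(char_poly B).
move/colP/(_ a); rewrite [LHS]mxE [RHS]mxE => /mulfI.
rewrite mxE => -> ; last exact/monic_neq0/char_poly_monic.
by rewrite mxE; apply: eq_bigr => l _; rewrite [w _ _]mxE mulrC mul_polyC.
Qed.

(** Induction on the size: column [b] of the adjugate is expressed by the adjugate
    of the submatrix without index [b], and the Newton cone of the submatrix is
    contained in that of [A] by interlacing. *)
Lemma adjugate_newton_cone n (A U : 'M[R]_n) (s : nat -> R) a b :
  (forall i j, i != j -> 0 <= A i j) ->
  U *m U^T = 1%:M -> A = U *m diag_mx (\row_k s k) *m U^T ->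
  (forall j k, (j <= k < n)%N -> s k <= s j) ->
  newton_cone s n ((\adj (char_poly_mx A)) a b).
Proof.
elim: n A U s a b => [|n IH] A U s a b A0 UU AE sdec; first by case: a.
pose B := row' b (col' b A).
have Asym : A^T = A by rewrite AE !trmx_mul trmxK tr_diag_mx mulmxA.
have Bsym : B^T = B by rewrite tr_row' tr_col' Asym; apply/matrixP => i j; rewrite !mxE.
have [V [m [VV BE mdec]]] := orth_diag_sorted Bsym.
have ms l : (l < n)%N -> m l <= s l.
  by move=> ln; apply: (eigenvalue_interlacing UU AE sdec VV BE mdec ln).
have sdec' i k : (i <= k < n)%N -> s k <= s i.
  by case/andP=> ik kn; rewrite sdec // ik ltnW.
case: (unliftP b a) => [a' ->|->].
  rewrite adjugate_offdiag; apply: newton_cone_sum => l.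
  apply: newton_coneZ; first by rewrite A0 // eq_sym neq_lift.
  apply: (newton_cone_widen (leqnSn n)); apply: (newton_coneW sdec' ms).
  apply: (IH _ V) => // i j ij.
  by rewrite !mxE A0 // (inj_eq lift_inj).
rewrite adjugate_diag -/B BE char_poly_orth_diag //.
have -> : \prod_(i < n) ('X - ((\row_k m k) 0 i)%:P) = newton_basis m n.
  by rewrite /newton_basis; apply: eq_bigr => i _; rewrite mxE.
exact: newton_basis_cone sdec' ms (leqnn n).
Qed.

End Adjugate.

(** Multiplied by [X - A], written as [(X - s_j) - (A - s_j)], the sum telescopes
    to [char_poly A - char_poly(A)], and the second term vanishes by
    Cayley-Hamilton. *)
Lemma adjugate_newtonE (R : rcfType) n (A U : 'M[R]_n.+1) (s : nat -> R) a b :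
  U *m U^T = 1%:M -> A = U *m diag_mx (\row_k s k) *m U^T ->
  (\adj (char_poly_mx A)) a b = \sum_(j < n.+1)
    (horner_mx A (\prod_(j.+1 <= i < n.+1) ('X - (s i)%:P))) a b *: newton_basis s j.
Proof.
move=> UU AE; pose Z j : {poly R} := \prod_(j <= i < n.+1) ('X - (s i)%:P).
pose M := char_poly_mx A; pose Q (p : {poly R}) := map_mx polyC (horner_mx A p).
have charE : char_poly A = newton_basis s n.+1.
  by rewrite AE char_poly_orth_diag // /newton_basis; apply: eq_bigr => i _; rewrite mxE.
have step (j : nat) : (j < n.+1)%N -> M *m (newton_basis s j *: Q (Z j.+1)) =
    newton_basis s j.+1 *: Q (Z j.+1) - newton_basis s j *: Q (Z j).
  move=> jn; have -> : M = ('X - (s j)%:P)%:M - map_mx polyC (A - (s j)%:M).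
    by rewrite map_mxB map_scalar_mx raddfB /= opprB addrA subrK.
  rewrite mulmxBl mul_scalar_mx scalerA mulrC -newton_basisS -scalemxAr -map_mxM.
  congr (_ - _ *: map_mx _ _).
  by rewrite /Z [in RHS]big_ltn // rmorphM /= rmorphB /= horner_mx_X horner_mx_C.
pose T := \sum_(j < n.+1) newton_basis s j *: Q (Z j.+1).
have MT : M *m T = (char_poly A)%:M.
  rewrite /T mulmx_sumr.
  rewrite (eq_bigr (fun j : 'I_n.+1 =>
    newton_basis s j.+1 *: Q (Z j.+1) - newton_basis s j *: Q (Z j))); last first.
    by move=> j _; exact: step.
  rewrite -(big_mkord xpredT (fun j => newton_basis s j.+1 *: Q (Z j.+1) -
    newton_basis s j *: Q (Z j))) (telescope_sumr (fun j => newton_basis s j *: Q (Z j))) //.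
  have -> : Z 0%N = char_poly A.
    by rewrite charE /newton_basis -(big_mkord xpredT (fun i => 'X - (s i)%:P)).
  rewrite /Q Cayley_Hamilton map_mx0 scaler0 subr0 /Z big_geq // rmorph1 map_mx1.
  by rewrite scalemx1 charE.
have adjE : \adj M = T.
  have := congr1 (mulmx (\adj M)) MT.
  rewrite mulmxA mul_adj_mx mul_scalar_mx mul_mx_scalar -/(char_poly A) => TE.
  apply/matrixP => i j; move/matrixP/(_ i j): TE; rewrite !mxE => /mulfI -> //.
  exact/monic_neq0/char_poly_monic.
rewrite adjE /T summxE; apply: eq_bigr => j _.
by rewrite !mxE mulrC mul_polyC.
Qed.

(** The product runs over the smallest eigenvalues, as [s] is decreasing. By
    [adjugate_newtonE] its entries are the Newton coefficients of the adjugate,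
    which are unique. *)
Theorem micchelli_willoughby (R : rcfType) n (A U : 'M[R]_n.+1) (s : nat -> R) j a b :
  (forall i j, i != j -> 0 <= A i j) ->
  U *m U^T = 1%:M -> A = U *m diag_mx (\row_k s k) *m U^T ->
  (forall j k, (j <= k < n.+1)%N -> s k <= s j) -> (j <= n)%N ->
  0 <= (horner_mx A (\prod_(j.+1 <= i < n.+1) ('X - (s i)%:P))) a b.
Proof.
move=> A0 UU AE sdec jn.
have [c c0] := adjugate_newton_cone a b A0 UU AE sdec.
rewrite (adjugate_newtonE a b UU AE) => /eqP; rewrite -subr_eq0 -sumrB => /eqP E.
pose q j := (horner_mx A (\prod_(j.+1 <= i < n.+1) ('X - (s i)%:P))) a b - c j.
have q0 := @newton_basis_free R s n.+1 q.
suff /(_ j jn) : forall k, (k < n.+1)%N -> q k = 0.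
  by rewrite /q => /eqP; rewrite subr_eq0 => /eqP ->.
by apply: q0; rewrite -[RHS]E; apply: eq_bigr => k _; rewrite scalerBl.
Qed.

(** * Divided differences *)

(** Rolle's theorem between consecutive zeros gives [k] ordered zeros of the next
    derivative, to which the induction hypothesis applies. *)
Lemma iterated_rolle (R : realType) (G : nat -> R -> R) (x : nat -> R) k :
  (forall i (t : R), 0 < t -> is_derive t 1 (G i) (G i.+1 t)) ->
  0 < x 0%N -> (forall i, (i < k)%N -> x i < x i.+1) ->
  (forall i, (i <= k)%N -> G 0%N (x i) = 0) ->
  exists xi, [/\ x 0%N <= xi, xi <= x k & G k xi = 0].
Proof.
elim: k G x => [|k IH] G x dG x0 xS Gx; first by exists (x 0%N); rewrite lexx Gx.
have x_gt0 i : (i <= k.+1)%N -> 0 < x i.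
  by elim: i => // i IHi ik; rewrite (lt_trans (IHi (ltnW ik))) ?xS.
have roll i : exists y, (i < k.+1)%N -> [/\ x i < y, y < x i.+1 & G 1%N y = 0].
  case: (ltnP i k.+1) => ik; last by exists 0.
  have dGi (t : R) : x i <= t -> is_derive t 1 (G 0%N) (G 1%N t).
    by move=> xt; apply: dG; apply: lt_le_trans xt; apply: x_gt0; exact: ltnW.
  have dr (t : R) : t \in `]x i, x i.+1[ -> derivable (G 0%N) t 1.
    by rewrite in_itv /= => /andP[/ltW /dGi ? _]; exact: ex_derive.
  have ct : {within `[x i, x i.+1], continuous (G 0%N)}.
    apply: derivable_within_continuous => t; rewrite in_itv /= => /andP[/dGi ? _].
    exact: ex_derive.
  have e : G 0%N (x i) = G 0%N (x i.+1) by rewrite !Gx // ltnW.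
  have [y xy_ dy] := Rolle (xS i ik) dr ct e.
  move: xy_; rewrite in_itv /= => /andP[xy yx]; exists y; split => //.
  have /dGi dy' := ltW xy.
  by rewrite -(@derive_val _ _ _ _ _ _ _ dy') (@derive_val _ _ _ _ _ _ _ dy).
have [y yP] := choice roll.
have dG' i (t : R) : 0 < t -> is_derive t 1 (G i.+1) (G i.+2 t) by exact: dG.
have y0_gt0 : 0 < y 0%N.
  by have [xy _ _] := yP 0%N isT; apply: lt_trans xy; exact: x_gt0.
have yS i : (i < k)%N -> y i < y i.+1.
  move=> ik; have [_ yx _] := yP i (leqW ik); have [xy _ _] := yP i.+1 ik.
  exact: lt_trans yx xy.
have Gy i : (i <= k)%N -> G 1%N (y i) = 0 by move=> ik; have [] := yP i ik.
have [xi [y0 yk Gxi]] := IH (fun i => G i.+1) y dG' y0_gt0 yS Gy.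
exists xi; split => //.
  by have [/ltW xy _ _] := yP 0%N isT; exact: le_trans xy y0.
by have [_ /ltW yx _] := yP k (ltnSn k); exact: le_trans yk yx.
Qed.

Section Interpolation.
Variables (R : realType) (g : R -> R) (x : nat -> R).

Fixpoint newton_interp (n : nat) : {poly R} :=
  if n is k.+1 then newton_interp k +
    ((g (x k) - (newton_interp k).[x k]) / (newton_basis x k).[x k]) *: newton_basis x k
  else 0.

Definition divided_diff k :=
  (g (x k) - (newton_interp k).[x k]) / (newton_basis x k).[x k].

Lemma newton_interpE n :
  newton_interp n = \sum_(j < n) divided_diff j *: newton_basis x j.
Proof. by elim: n => [|n IH]; rewrite ?big_ord0 // big_ord_recr /= -IH. Qed.

Lemma horner_newton_basis (s : nat -> R) k t :
  (newton_basis s k).[t] = \prod_(i < k) (t - s i).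
Proof. by rewrite horner_prod; apply: eq_bigr => i _; rewrite !hornerE. Qed.

Lemma newton_interp_node n j :
  (forall i k, (i < k < n)%N -> x i != x k) -> (j < n)%N ->
  (newton_interp n).[x j] = g (x j).
Proof.
elim: n => [//|n IH] xD; rewrite ltnS leq_eqVlt => /predU1P[->|jn] /=.
  rewrite hornerD hornerZ divfK ?subrKC //.
  rewrite horner_newton_basis; apply/prodf_neq0 => i _.
  by rewrite subr_eq0 eq_sym xD // ltn_ord ltnSn.
rewrite hornerD hornerZ (horner_newton_basis x n (x j)) (bigD1 (Ordinal jn)) //= subrr mul0r.
rewrite mulr0 addr0 IH // => i k /andP[ik kn]; apply: xD; rewrite ik; exact: ltnW.
Qed.

Lemma size_newton_interp n : (size (newton_interp n) <= n)%N.
Proof.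
rewrite newton_interpE (leq_trans (size_sum _ _ _)) //; apply/bigmax_leqP => j _.
by rewrite (leq_trans (size_scale_leq _ _)) // size_newton_basis.
Qed.

Lemma coef_newton_interp n : (newton_interp n.+1)`_n = divided_diff n.
Proof.
rewrite /= coefD nth_default ?size_newton_interp // add0r coefZ.
have := newton_basis_monic x n; rewrite monicE lead_coefE size_newton_basis /=.
by move=> /eqP ->; rewrite mulr1.
Qed.

(** The difference of [g] and its interpolation polynomial at
    [x 0, ..., x k] vanishes at these [k + 1] points, and the [k]-th derivative
    of the polynomial is constant. *)
Lemma divided_diff_mean (G : nat -> R -> R) k :
  (forall t, 0 < t -> G 0%N t = g t) ->
  (forall i (t : R), 0 < t -> is_derive t 1 (G i) (G i.+1 t)) ->
  0 < x 0%N -> (forall i j, (i < j <= k)%N -> x i < x j) ->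
  exists xi, [/\ x 0%N <= xi, xi <= x k & G k xi = divided_diff k * k`!%:R].
Proof.
move=> G0 dG x0 xI; pose p := newton_interp k.+1.
have x_gt0 i : (i <= k)%N -> 0 < x i.
  by case: i => // i ik; apply: lt_trans x0 _; exact: xI.
have dH i (t : R) : 0 < t ->
    is_derive t 1 (fun t => G i t - (p^`(i)).[t]) (G i.+1 t - (p^`(i.+1)).[t]).
  by move=> t0; have := dG i t t0 => dGi; rewrite derivnS; apply: is_deriveB.
have xS i : (i < k)%N -> x i < x i.+1 by move=> ik; apply: xI; rewrite ltnSn.
have H0 i : (i <= k)%N -> G 0%N (x i) - (p^`(0)).[x i] = 0.
  move=> ik; rewrite derivn0 G0 ?x_gt0 // newton_interp_node ?subrr // => a b /andP[ab bk].
  by rewrite lt_eqF // xI // ab -ltnS.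
have [xi [x0xi xixk /eqP]] :=
  @iterated_rolle R (fun i t => G i t - (p^`(i)).[t]) x k dH x0 xS H0.
rewrite subr_eq0 => /eqP Gk; exists xi; split => //; rewrite Gk.
have -> : p^`(k) = (p`_k *+ k`!)%:P.
  apply/polyP => i; rewrite coef_derivn coefC; case: eqP => [->|/eqP i0].
    by rewrite addn0 ffactnn.
  rewrite nth_default ?mul0rn // (leq_trans (size_newton_interp _)) //.
  by rewrite -addn1 leq_add2l lt0n.
by rewrite hornerC coef_newton_interp mulr_natr.
Qed.

End Interpolation.

(** * The derivatives of x^p (x + u)^q *)

Section Derivatives.
Variables (R : realType).

Definition falling (z : R) (n : nat) : R := \prod_(j < n) (z - j%:R).

Lemma fallingS z n : falling z n.+1 = falling z n * (z - n%:R).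
Proof. by rewrite /falling big_ord_recr. Qed.

Lemma fallingSl z n : falling (z + 1) n.+1 = (z + 1) * falling z n.
Proof.
rewrite /falling big_ord_recl subr0; congr (_ * _); apply: eq_bigr => i _.
by rewrite lift0 -natr1; ring.
Qed.

Lemma falling_ge0 z n : n%:R - 1 <= z -> 0 <= falling z n.
Proof.
move=> nz; apply: prodr_ge0 => j _; rewrite subr_ge0; apply: le_trans nz.
by rewrite lerBrDr natr1 ler_nat.
Qed.

Variables (p q u : R).
Hypothesis u0 : 0 < u.

(** Coefficient of [x^i] in the polynomial factor of the [k]-th derivative of
    [x^p (x + u)^q]. *)
Definition deriv_coef k i : R :=
  'C(k, i)%:R * falling p (k - i) * falling (p + q - k%:R + i%:R) i * u ^+ (k - i).

Definition iter_deriv k (x : R) : R :=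
  \sum_(i < k.+1) deriv_coef k i * (x `^ (p - k%:R + i%:R) * (x + u) `^ (q - k%:R)).

Lemma deriv_coef0 k : deriv_coef k.+1 0 = (p - k%:R) * u * deriv_coef k 0.
Proof.
by rewrite /deriv_coef !bin0 !subn0 fallingS exprS /falling !big_ord0; ring.
Qed.

(** Together with [deriv_coef0], the recurrence imposed by differentiating
    [x^(p-k+i) (x + u)^(q-k)]. It reduces to
    [(i + 1) C(k, i + 1) = (k - i) C(k, i)]. *)
Lemma deriv_coefS k i : (i <= k)%N -> deriv_coef k.+1 i.+1 =
  (p - k%:R + i.+1%:R) * u * deriv_coef k i.+1 + (p + q - k%:R *+ 2 + i%:R) * deriv_coef k i.
Proof.
move=> ik; rewrite /deriv_coef subSS.
have -> : p + q - k.+1%:R + i.+1%:R = p + q - k%:R + i%:R by rewrite -!natr1; ring.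
have -> : p + q - k%:R + i.+1%:R = p + q - k%:R + i%:R + 1 by rewrite -!natr1; ring.
rewrite fallingSl [falling _ i.+1]fallingS.
set F := falling (p + q - k%:R + i%:R) i.
have := mul_bin_left k i => /(congr1 (fun m => m%:R : R)); rewrite !natrM natrB // => B.
rewrite binS natrD.
case: (ltnP i k) => ik'; last first.
  have -> : i = k by lia.
  rewrite bin_small // subnn binn; ring.
have -> : (k - i = (k - i.+1).+1)%N by lia.
rewrite fallingS exprS natrB //.
set P := falling p _; set V := u ^+ _.
transitivity (P * (p - (k%:R - i.+1%:R)) * F * u * V *
   ('C(k, i.+1)%:R * (p + q - k%:R) + 'C(k, i)%:R * (p + q - k%:R))); first ring.
transitivity (P * (p - (k%:R - i.+1%:R)) * F * u * V *
   ('C(k, i.+1)%:R * (p + q - k%:R) + i.+1%:R * 'C(k, i.+1)%:R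
     + 'C(k, i)%:R * (p + q - k%:R *+ 2 + i%:R))); last by rewrite -natr1; ring.
rewrite B; ring.
Qed.

Lemma powR_pred a (x : R) : 0 < x -> x `^ a = x * x `^ (a - 1).
Proof.
move=> x0; have xn : x != 0 by rewrite gt_eqF.
by rewrite powRB ?xn ?implybT // powRr1 ?ltW // mulrC divfK.
Qed.

(** The product rule, where [a (x + u) + c x] is regrouped as [(a + c) x + a u] so that
    both terms carry the same power of [x + u] and only the coefficients
    [a + c] and [a u] appear. *)
Lemma is_derive_powR_prod a c (x : R) : 0 < x ->
  is_derive x 1 (fun x => x `^ a * (x + u) `^ c)
    ((a + c) * (x `^ a * (x + u) `^ (c - 1)) + a * u * (x `^ (a - 1) * (x + u) `^ (c - 1))).
Proof.
move=> x0; have xu0 : 0 < x + u by rewrite addr_gt0.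
have dx := is_derive1_powR a x0.
have dxu : is_derive x 1 (fun x => (x + u) `^ c) (c * (x + u) `^ (c - 1)).
  have := is_derive1_powR c xu0 => dc.
  have dd : is_derive x 1 (fun x : R => x + u) 1.
    by rewrite -[1 in X in is_derive _ _ _ X]addr0; apply: is_deriveD.
  have := is_derive1_comp (f := fun y : R => y `^ c) (g := fun x : R => x + u) dc dd.
  by rewrite mulr1.
apply: is_derive_eq (is_deriveM dx dxu) _.
rewrite (powR_pred a x0) (powR_pred c xu0).
rewrite /GRing.scale /=; ring.
Qed.

Lemma is_derive_iter_deriv k (x : R) : 0 < x ->
  is_derive x 1 (iter_deriv k) (iter_deriv k.+1 x).
Proof.
move=> x0.
pose X i := x `^ (p - k.+1%:R + i%:R) * (x + u) `^ (q - k.+1%:R).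
pose d i := deriv_coef k i *
  ((p + q - k%:R *+ 2 + i%:R) * X i.+1 + (p - k%:R + i%:R) * u * X i).
have dS : is_derive x 1 (iter_deriv k) (\sum_(i < k.+1) d i).
  have -> : iter_deriv k = \sum_(i < k.+1)
     (fun x => deriv_coef k i * (x `^ (p - k%:R + i%:R) * (x + u) `^ (q - k%:R))).
    by apply/funext => y; rewrite fct_sumE.
  apply: is_derive_sum => i.
  apply: is_derive_eq.
    exact: (is_deriveZ (deriv_coef k i) (is_derive_powR_prod (p - k%:R + i%:R) (q - k%:R) x0)).
  rewrite /d /X /GRing.scale /=; 
    congr (_ * (_ * (_ `^ _ * _ `^ _) + _ * _ * (_ `^ _ * _ `^ _)));
  rewrite -?natr1; ring.
apply: is_derive_eq dS _; rewrite /iter_deriv -/(X _).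
rewrite [RHS]big_ord_recl /= deriv_coef0.
rewrite [X in _ = _ + X](eq_bigr (fun i : 'I_k.+1 =>
   (p - k%:R + i.+1%:R) * u * deriv_coef k i.+1 * X i.+1 +
   (p + q - k%:R *+ 2 + i%:R) * deriv_coef k i * X i.+1)); last first.
  by move=> i _; rewrite ?lift0 /bump ?leq0n ?add1n deriv_coefS ?mulrDl // -ltnS.
rewrite big_split /= addrA.
transitivity (\sum_(i < k.+1) (p - k%:R + i%:R) * u * deriv_coef k i * X i +
   \sum_(i < k.+1) (p + q - k%:R *+ 2 + i%:R) * deriv_coef k i * X i.+1).
  by rewrite -big_split; apply: eq_bigr => i _; rewrite /d /=; ring.
congr (_ + _); rewrite big_ord_recl addr0; congr (_ + _).
rewrite [RHS]big_ord_recr /= /deriv_coef bin_small // !mul0r mulr0 mul0r addr0.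
by apply: eq_bigr => i _.
Qed.

Lemma iter_deriv0 (x : R) : iter_deriv 0 x = x `^ p * (x + u) `^ q.
Proof.
rewrite /iter_deriv big_ord1 /deriv_coef bin0 subnn /falling !big_ord0 !subr0 !addr0.
by rewrite expr0 !mul1r.
Qed.

Lemma iter_deriv_ge0 k (x : R) : k%:R - 1 <= p -> k%:R - 1 <= p + q ->
  0 <= iter_deriv k x.
Proof.
move=> kp ks; apply: sumr_ge0 => i _; rewrite /deriv_coef.
rewrite !mulr_ge0 ?powR_ge0 ?ler0n ?exprn_ge0 ?(ltW u0) //; apply: falling_ge0.
  by rewrite (le_trans _ kp) // lerD2r ler_nat leq_subr.
lra.
Qed.

Lemma poly_lt0_right (P : {poly R}) : P.[0] < 0 -> exists2 t, 0 < t & P.[t] < 0.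
Proof.
move=> P0; have Pc : (P.[t] @[t --> 0^'+] --> P.[0]).
  by apply: cvg_at_right_filter; exact: continuous_horner.
have Pn : \forall t \near 0^'+, P.[t] < 0 by exact: (cvgr_lt P.[0]).
have /filter_ex [t [t0 Pt]] : \forall t \near (0 : R)^'+, 0 < t /\ P.[t] < 0.
  by apply: filterI => //; exact: nbhs_right_gt.
by exists t.
Qed.

Lemma iter_deriv_factor k (x : R) : 0 < x -> iter_deriv k x =
  x `^ (p - k%:R) * (x + u) `^ (q - k%:R) * \sum_(i < k.+1) deriv_coef k i * x ^+ i.
Proof.
move=> x0; rewrite /iter_deriv mulr_sumr; apply: eq_bigr => i _.
rewrite powRD; last by rewrite (gt_eqF x0) implybT.
by rewrite powR_mulrn ?ltW //; ring.
Qed.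

(** As [x] tends to [0], the constant coefficient [(p)_k u^k] decides the sign. *)
Lemma iter_deriv_lt0_near0 k : falling p k < 0 -> exists2 t, 0 < t & iter_deriv k t < 0.
Proof.
move=> fp; pose P : {poly R} := \poly_(i < k.+1) deriv_coef k i.
have [|t t0 Pt] := @poly_lt0_right P.
  rewrite horner_coef0 coef_poly /= /deriv_coef bin0 subn0 mul1r.
  by rewrite /(falling _ 0) big_ord0 mulr1 pmulr_llt0 ?exprn_gt0.
exists t => //; rewrite iter_deriv_factor // pmulr_rlt0.
  by rewrite -horner_poly.
by rewrite mulr_gt0 ?powR_gt0 ?addr_gt0.
Qed.

(** As [x] tends to infinity, the leading coefficient [(p + q)_k] decides the
    sign; the substitution [z = 1 / x] turns it into a constant coefficient. *)
Lemma iter_deriv_lt0_nearoo k : falling (p + q) k < 0 -> exists2 t, 0 < t & iter_deriv k t < 0.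
Proof.
move=> fs; pose P : {poly R} := \poly_(i < k.+1) deriv_coef k (k - i).
have [|z z0 Pz] := @poly_lt0_right P.
  rewrite horner_coef0 coef_poly /= /deriv_coef subn0 subnn binn mul1r.
  by rewrite /(falling p 0) big_ord0 mul1r mulr1 subrK.
have zV0 : 0 < z^-1 by rewrite invr_gt0.
exists z^-1 => //; rewrite iter_deriv_factor // pmulr_rlt0; last first.
  by rewrite mulr_gt0 ?powR_gt0 ?addr_gt0.
have -> : \sum_(i < k.+1) deriv_coef k i * z^-1 ^+ i = z^-1 ^+ k * P.[z].
  rewrite horner_poly mulr_sumr (reindex_inj rev_ord_inj) /=; apply: eq_bigr => i _.
  rewrite subSS exprB ?unitfE ?gt_eqF //; last by rewrite -ltnS.
  by rewrite mulrCA -exprVn invrK; ring.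
by rewrite pmulr_rlt0 // exprn_gt0.
Qed.

(** Only continuity from the right is available at [l = 0], and this is the form
    in which the perturbed nodes approach the eigenvalues. *)
Lemma powR_prod_cvg_right (l c : R) : 0 <= p -> 0 <= l -> 0 < c ->
  (l + c * e) `^ p * (l + c * e + u) `^ q @[e --> 0^'+] --> l `^ p * (l + u) `^ q.
Proof.
move=> p0 l0 c0.
have lin (a : R) : a + c * e @[e --> 0^'+] --> a.
  apply: cvg_at_right_filter; rewrite -[X in _ --> X]addr0 -[X in _ --> a + X](mulr0 c).
  by apply: cvgD; [exact: cvg_cst|apply: cvgM; [exact: cvg_cst|exact: cvg_id]].
have powc (a b : R) : 0 < a -> (a + c * e) `^ b @[e --> 0^'+] --> a `^ b.
  move=> a0; have da := is_derive1_powR b a0.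
  have /derivable1_diffP/differentiable_continuous cb : derivable (fun y : R => y `^ b) a 1.
    exact: ex_derive.
  exact: (continuous_cvg _ cb (lin a)).
apply: cvgM; last first.
  have -> : (fun e => (l + c * e + u) `^ q) = (fun e => ((l + u) + c * e) `^ q).
    by apply/funext => e; rewrite addrAC.
  by apply: powc; rewrite ltr_wpDl.
move: l0; rewrite le_eqVlt => /predU1P[<-|]; last exact: powc.
move: p0; rewrite le_eqVlt => /predU1P[<-|p0].
  by under eq_fun do rewrite powRr0; rewrite powRr0; exact: cvg_cst.
rewrite powR0 ?gt_eqF //.
have cp0 : c `^ p * e `^ p @[e --> 0^'+] --> (0 : R).
  rewrite -[X in _ --> X](mulr0 (c `^ p)).
  by apply: cvgM; [exact: cvg_cst|exact: powR_cvg0].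
apply: cvg_trans cp0; apply: near_eq_cvg; near=> e.
by rewrite add0r powRM // ltW.
Unshelve. all: by end_near. Qed.

End Derivatives.

(** * Entrywise nonnegativity of functions of a matrix *)

Lemma horner_mx_orth_diag (F : fieldType) n (U : 'M[F]_n.+1) (d : 'rV[F]_n.+1) P :
  U *m U^T = 1%:M ->
  horner_mx (U *m diag_mx d *m U^T) P = U *m diag_mx (map_mx (horner P) d) *m U^T.
Proof.
move=> UU; have Uu : U \in unitmx by have [] := mulmx1_unit UU.
have -> : U^T = invmx U by rewrite -[LHS](mulKmx Uu) UU mulmx1.
by rewrite horner_mx_uconj // horner_mx_diag.
Qed.

Section Positivity.
Variables (R : realType) (n : nat) (A U : 'M[R]_n.+1) (s : nat -> R) (g : R -> R).
Hypothesis A0 : forall i j, i != j -> 0 <= A i j.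
Hypothesis UU : U *m U^T = 1%:M.
Hypothesis AE : A = U *m diag_mx (\row_k s k) *m U^T.
Hypothesis sdec : forall j k, (j <= k < n.+1)%N -> s k <= s j.
Hypothesis s0 : forall i, (i <= n)%N -> 0 <= s i.
Hypothesis g_dd : forall x : nat -> R, 0 < x 0%N ->
  (forall i j, (i < j <= n)%N -> x i < x j) ->
  forall k, (k <= n)%N -> 0 <= divided_diff g x k.
Hypothesis g_cont : forall l c, 0 <= l -> 0 < c ->
  g (l + c * e) @[e --> 0^'+] --> g l.

(* r lists the eigenvalues in increasing order, and x e separates them. *)
Let r i := s (n - i).
Let x (e : R) i := r i + i.+1%:R * e.

Let r_le i j : (i <= j <= n)%N -> r i <= r j.
Proof. by move=> /andP[ij jn]; apply: sdec; lia. Qed.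

Let x_gt0 e i : 0 < e -> (i <= n)%N -> 0 < x e i.
Proof.
by move=> e0 i_n; rewrite ltr_wpDl ?mulr_gt0 ?ltr0Sn // s0 // leq_subr.
Qed.

Let x_lt e i j : 0 < e -> (i < j <= n)%N -> x e i < x e j.
Proof.
move=> e0 /andP[ij jn]; rewrite ler_ltD ?r_le ?(ltnW ij) //.
by rewrite ltr_pM2r // ltr_nat.
Qed.

(* The coefficients interpolate g at the separated nodes, but the Newton basis
   is that of the true eigenvalues, to which the Micchelli-Willoughby theorem
   applies. *)
Let p e := \sum_(k < n.+1) divided_diff g (x e) k *: newton_basis r k.

Let newton_basis_rE k : (k <= n.+1)%N ->
  newton_basis r k = \prod_(n.+1 - k <= i < n.+1) ('X - (s i)%:P).
Proof.
elim: k => [_|k IH kn]; first by rewrite /newton_basis big_ord0 subn0 big_geq.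
rewrite newton_basisS IH ?(ltnW kn) // subSS [RHS]big_ltn; last by rewrite ltnS leq_subr.
by rewrite mulrC subSn.
Qed.

Let p_ge0 e a b : 0 < e -> 0 <= (horner_mx A (p e)) a b.
Proof.
move=> e0; rewrite /p linear_sum summxE; apply: sumr_ge0 => k _.
have kn : (k <= n)%N by rewrite -ltnS.
rewrite linearZ mxE mulr_ge0 //.
  apply: g_dd => //; first exact: x_gt0.
  by move=> i j; exact: x_lt.
rewrite (newton_basis_rE (leqW kn)) (subSn kn).
exact: (micchelli_willoughby a b A0 UU AE sdec (leq_subr k n)).
Qed.

(* At the first index m of a cluster of equal eigenvalues, g (x e m) is a sum of
   nonnegative terms T k, and p e takes at r m the value obtained by multiplying
   each T k by a product of ratios F j in [0, 1]. All those ratios tend to 1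
   with e, because r j < r m for j < m. Comparing terms in this way avoids the
   divided differences themselves, which could blow up as nodes merge. *)
Let p_first e m : 0 < e -> (m <= n)%N -> (forall j, (j < m)%N -> r j < r m) ->
  g (x e m) * (\prod_(j < m) ((r m - r j) / (x e m - x e j))) <= (p e).[r m] <= g (x e m).
Proof.
move=> e0 mn rm; have dd := g_dd (x_gt0 e0 (leq0n n)) (fun i j => @x_lt e i j e0).
pose F j := (r m - r j) / (x e m - x e j).
have dx j : (j < m)%N -> 0 < x e m - x e j.
  by move=> jm; rewrite subr_gt0 x_lt // jm.
have dr j : (j < m)%N -> 0 < r m - r j <= x e m - x e j.
  move=> jm; rewrite subr_gt0 rm //= /x opprD addrACA lerDl -mulrBl mulr_ge0 ?(ltW e0) //.
  by rewrite subr_ge0 ler_nat ltnS ltnW.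
have F01 j : (j < m)%N -> 0 <= F j <= 1.
  move=> jm; have /andP[/ltW ? ?] := dr j jm; have := dx j jm => dxj.
  by rewrite divr_ge0 ?(ltW dxj) //= ler_pdivrMr // mul1r.
pose T k := divided_diff g (x e) k * \prod_(j < k) (x e m - x e j).
have T0 k : (k <= m)%N -> 0 <= T k.
  move=> km; rewrite mulr_ge0 ?dd ?(leq_trans km) //; apply: prodr_ge0 => j _.
  by rewrite ltW // dx // (leq_trans (ltn_ord j)).
have gE : g (x e m) = \sum_(k < m.+1) T k.
  rewrite -(@newton_interp_node _ g (x e) m.+1 m) //; last first.
    by move=> i k /andP[ik km]; rewrite lt_eqF // x_lt // ik (leq_trans _ mn).
  rewrite newton_interpE horner_sum; apply: eq_bigr => k _.
  by rewrite hornerZ horner_newton_basis.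
have pE : (p e).[r m] = \sum_(k < m.+1) T k * \prod_(j < k) F j.
  rewrite horner_sum.
  rewrite -(big_mkord xpredT (fun k => (divided_diff g (x e) k *: newton_basis r k).[r m])).
  rewrite (big_cat_nat (n := m.+1)) //= [X in _ + X]big_nat_cond.
  rewrite [X in _ + X]big1 ?addr0; last first.
    move=> k; rewrite andbT => /andP[mk _]; rewrite hornerZ horner_newton_basis.
    by rewrite (bigD1 (Ordinal mk)) //= subrr mul0r mulr0.
  rewrite big_mkord; apply: eq_bigr => k _.
  rewrite hornerZ horner_newton_basis /T -mulrA -big_split /=; congr (_ * _).
  apply: eq_bigr => j _; rewrite /F mulrC divfK // gt_eqF // dx //.
  by rewrite (leq_trans (ltn_ord j)) // -ltnS.
rewrite pE gE; apply/andP; split.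
  rewrite mulr_suml; apply: ler_sum => k _; apply: ler_wpM2l; first by rewrite T0 // -ltnS.
  have km : (k <= m)%N by rewrite -ltnS.
  have -> : \prod_(j < m) ((r m - r j) / (x e m - x e j)) =
      (\prod_(j < k) F j) * \prod_(k <= j < m) F j.
    by rewrite -(big_mkord xpredT F) -(big_mkord xpredT F) -big_cat_nat.
  rewrite ler_piMr //.
    by apply: prodr_ge0 => j _; have /andP[] := F01 j (leq_trans (ltn_ord j) km).
  rewrite big_nat_cond; apply: prodr_ile1 => j; rewrite andbT => /andP[_ jm].
  exact: F01.
apply: ler_sum => k _; have km : (k <= m)%N by rewrite -ltnS.
rewrite ler_piMr ?T0 //; apply: prodr_ile1 => j _.
exact: F01 (leq_trans (ltn_ord j) km).
Qed.

Let p_cvg i : (i <= n)%N -> (p e).[r i] @[e --> 0^'+] --> g (r i).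
Proof.
move=> i_n; have exm : exists m, r m == r i by exists i.
have [m /eqP rmi mmin] := ex_minnP exm.
have mi : (m <= i)%N by apply: mmin.
have mn := leq_trans mi i_n.
have rm j : (j < m)%N -> r j < r m.
  move=> jm; rewrite lt_neqAle r_le ?(ltnW jm) // andbT; apply/negP => /eqP E.
  by have := mmin j; rewrite E rmi eqxx leqNgt jm => /(_ isT).
rewrite -rmi.
have gx : g (x e m) @[e --> 0^'+] --> g (r m).
  by apply: g_cont; rewrite ?ltr0Sn // s0 // leq_subr.
apply: (@squeeze_cvgr _ _ _ _
  (fun e => g (x e m) * (\prod_(j < m) ((r m - r j) / (x e m - x e j))))
  (fun e => g (x e m))) => //.
  by near=> e; apply: p_first.
rewrite -[X in _ --> X]mulr1; apply: cvgM => //.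
have prod1 : \prod_(j < m) (1 : R) = 1 by rewrite big1.
rewrite -[X in _ --> X]prod1.
apply: cvg_big => [|j _]; first exact: mul_continuous.
have rj : r m - r j != 0 by rewrite gt_eqF // subr_gt0 rm.
rewrite -[X in _ --> X](divff rj); apply: cvgM; first exact: cvg_cst.
apply: cvgV => //.
have xc k : x e k @[e --> 0^'+] --> r k.
  apply: cvg_at_right_filter; rewrite -[X in _ --> X]addr0 -[X in _ --> _ + X](mulr0 k.+1%:R).
  by apply: cvgD; [exact: cvg_cst|apply: cvgM; [exact: cvg_cst|exact: cvg_id]].
by apply: cvgB.
Unshelve. all: by end_near. Qed.

(** The matrix [p e (A)] is entrywise nonnegative for [e > 0], and [p e] tends to
    [g] at every eigenvalue. *)
Lemma orth_diag_map_ge0 a b : 0 <= (U *m diag_mx (\row_k g (s k)) *m U^T) a b.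
Proof.
have lim : (horner_mx A (p e)) a b @[e --> 0^'+] -->
    (U *m diag_mx (\row_k g (s k)) *m U^T) a b.
  have -> : (fun e => (horner_mx A (p e)) a b) =
      (fun e => \sum_k U a k * (p e).[s k] * U b k).
    apply/funext => e; rewrite {1}AE horner_mx_orth_diag // orth_diagE.
    by apply: eq_bigr => k _; rewrite !mxE.
  rewrite orth_diagE; apply: cvg_big => [|k _]; first exact: add_continuous.
  apply: cvgM; last exact: cvg_cst.
  apply: cvgM; first exact: cvg_cst.
  rewrite mxE; have -> : s k = r (n - k) by rewrite /r subKn // -ltnS.
  by apply: p_cvg; exact: leq_subr.
apply: (cvgr_to_ge lim); near=> e; exact: p_ge0.
Unshelve. all: by end_near. Qed.

End Positivity.

(** * A negative derivative excludes preservation *)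

Lemma orth_diag_psd (R : realType) n (U : 'M[R]_n) (d : 'rV[R]_n) :
  U *m U^T = 1%:M -> (forall k, 0 <= d 0 k) -> psdmx (U *m diag_mx d *m U^T).
Proof.
move=> UU d0; split; first by rewrite !trmx_mul trmxK tr_diag_mx mulmxA.
move=> v; have := quad_form_ge (d := d) (x := 0) UU (v := v^T).
by rewrite mul0r trmxK; apply.
Qed.

Lemma psd_orth_diag (R : realType) n (U : 'M[R]_n) (d : 'rV[R]_n) k :
  U *m U^T = 1%:M -> psdmx (U *m diag_mx d *m U^T) -> 0 <= d 0 k.
Proof.
move=> UU [_ /(_ (row k U^T)^T)]; rewrite trmxK quad_formE -row_mul (mulmx1C UU).
rewrite (bigD1 k) //= big1 ?addr0 => [|j jk]; rewrite !mxE ?eqxx ?expr1n ?mulr1 //.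
by rewrite eq_sym (negPf jk) expr0n mulr0.
Qed.

(** Pad the smaller matrix by zeros: a function acts on each diagonal block
    separately. *)
Lemma preserves_DN_sub (R : realType) (m r : nat) (g : R -> R) :
  preserves_DN (m + r) g -> preserves_DN m g.
Proof.
move=> gDN A [[Asym Apsd] A0]; pose B : 'M[R]_(m + r) := block_mx A 0 0 0.
have [U [d [UU AE]]] := orth_diag Asym.
pose W : 'M[R]_(m + r) := block_mx U 0 0 1%:M.
have WW : W *m W^T = 1%:M.
  rewrite /W tr_block_mx mulmx_block !trmx0 trmx1.
  by rewrite !(mulmx0, mul0mx, mulmx1, addr0, add0r) UU scalar_mx_block.
have WE (e1 : 'rV[R]_m) (e2 : 'rV[R]_r) : W *m diag_mx (row_mx e1 e2) *m W^T =
    block_mx (U *m diag_mx e1 *m U^T) 0 0 (diag_mx e2).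
  rewrite /W diag_mx_row tr_block_mx !mulmx_block !trmx0 trmx1.
  by rewrite !(mulmx0, mul0mx, mulmx1, mul1mx, addr0, add0r).
have BE : spectral_decomposition B (W, row_mx d 0).
  by split=> //=; rewrite WE -AE linear0.
have Bq (C : 'M[R]_m) (D : 'M[R]_r) v :
    ((col_mx v 0)^T *m (block_mx C 0 0 D) *m col_mx v 0) 0 0 = (v^T *m C *m v) 0 0.
  by rewrite tr_col_mx mul_row_block mul_row_col trmx0 !(mulmx0, mul0mx, addr0, add0r).
have BDN : doubly_nonneg B.
  split; last first.
    move=> i j; rewrite /B; case: (split_ordP i) => i' ->; case: (split_ordP j) => j' ->.
    - by rewrite block_mxEul.
    - by rewrite block_mxEur mxE.
    - by rewrite block_mxEdl mxE.
    - by rewrite block_mxEdr mxE.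
  split; first by rewrite /B tr_block_mx !trmx0 Asym.
  move=> v; rewrite -(vsubmxK v) tr_col_mx mul_row_block mul_row_col.
  by rewrite !(mulmx0, mul0mx, addr0, add0r).
have := gDN B BDN; rewrite (mxfunE g BE) (mxfunE g (conj UU AE)) /= map_row_mx WE.
move=> [[sym psd] ge0]; split; last first.
  by move=> i j; have := ge0 (lshift r i) (lshift r j); rewrite block_mxEul.
split; last by move=> v; have := psd (col_mx v 0); rewrite Bq.
by rewrite !trmx_mul trmxK tr_diag_mx mulmxA.
Qed.

Section Path.
Variables (R : realType) (k : nat).

(** With nonzero entries at most one place above the diagonal, [m] steps are
    needed to go from index [0] to index [m]. *)
Lemma hessenberg_exp (M : 'M[R]_k.+1) t :
  (forall i j : 'I_k.+1, (i.+1 < j)%N -> M i j = 0) ->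
  (forall i j : 'I_k.+1, i.+1 = j :> nat -> M i j = t) ->
  forall m (j : 'I_k.+1), (m <= j)%N -> (M ^+ m) 0 j = (m == j)%:R * t ^+ m.
Proof.
move=> M0 Mt; elim=> [|m IH] j mj.
  by rewrite !expr0 !mxE mulr1 -val_eqE.
rewrite exprSr mxE; have mk : (m < k.+1)%N by rewrite (leq_trans mj) // ltnW.
rewrite (bigD1 (Ordinal mk)) //= IH //= eqxx mul1r [X in _ + X]big1 ?addr0; last first.
  move=> i; rewrite -val_eqE /= => im; case: (ltnP m i) => mi.
    by rewrite IH ?(ltnW mi) // eq_sym (negPf im) !mul0r.
  by rewrite M0 ?mulr0 //; lia.
case: eqP => mj'; first by rewrite (Mt (Ordinal mk) j) //= mul1r exprSr.
by rewrite M0 /= ?mulr0 ?mul0r //; lia.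
Qed.

Lemma hessenberg_horner (M : 'M[R]_k.+1) t (P : {poly R}) :
  (forall i j : 'I_k.+1, (i.+1 < j)%N -> M i j = 0) ->
  (forall i j : 'I_k.+1, i.+1 = j :> nat -> M i j = t) ->
  (size P <= k.+1)%N -> (horner_mx M P) 0 ord_max = P`_k * t ^+ k.
Proof.
move=> M0 Mt sP.
have -> : P = \sum_(i < k.+1) P`_i *: 'X^i.
  rewrite -poly_def; apply/polyP => i; rewrite coef_poly; case: ltnP => // ki.
  by rewrite nth_default // (leq_trans sP).
rewrite linear_sum summxE -poly_def coef_poly ltnSn.
rewrite (bigD1 ord_max) //= linearZ mxE rmorphXn /= horner_mx_X (hessenberg_exp M0 Mt) //=.
rewrite eqxx mul1r big1 ?addr0 // => i; rewrite -val_eqE /= => ik.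
rewrite linearZ mxE rmorphXn /= horner_mx_X (hessenberg_exp M0 Mt) /=; last by rewrite -ltnS.
by rewrite (negPf ik) mul0r mulr0.
Qed.

Definition path_mx : 'M[R]_k.+1 :=
  \matrix_(i, j) ((i.+1 == j :> nat) || (j.+1 == i :> nat))%:R.

Lemma path_mx_sym : path_mx^T = path_mx.
Proof. by apply/matrixP => i j; rewrite !mxE orbC. Qed.

(** The eigenvalues are distinct: otherwise a monic polynomial of degree [k] would
    annihilate the matrix, although its entry between the two ends of the path
    is [1]. *)
Lemma path_mx_spectrum : exists (U : 'M[R]_k.+1) (s : nat -> R),
  [/\ U *m U^T = 1%:M, path_mx = U *m diag_mx (\row_i s i) *m U^T &
      (forall i j, (i < j <= k)%N -> s j < s i)].
Proof.
have [U [s [UU BE sdec]]] := orth_diag_sorted path_mx_sym.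
exists U, s; split => // i j /andP[ij jk].
rewrite lt_neqAle sdec ?(ltnW ij) // andbT; apply/negP => /eqP sij.
have ik : (i < k.+1)%N by lia.
pose j' : 'I_k.+1 := Ordinal (jk : (j < k.+1)%N).
pose Q : {poly R} := \prod_(l < k) ('X - (s (lift j' l))%:P).
have sQ : size Q = k.+1 by rewrite size_prod_XsubC /index_enum -enumT size_enum_ord.
have Qk : Q`_k = 1.
  have : Q \is monic by exact: monic_prod_XsubC.
  by rewrite monicE lead_coefE sQ => /eqP.
have B0 (a b : 'I_k.+1) : (a.+1 < b)%N -> path_mx a b = 0.
  by move=> ab; rewrite mxE; case: eqP => [?|_]; [lia|case: eqP => // ?; lia].
have B1 (a b : 'I_k.+1) : a.+1 = b :> nat -> path_mx a b = 1.
  by move=> ab; rewrite mxE ab eqxx.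
have := hessenberg_horner B0 B1 (eq_leq sQ).
rewrite Qk expr1n mulr1 BE horner_mx_orth_diag // orth_diagE big1 => [/esym/eqP|l _].
  by rewrite oner_eq0.
rewrite !mxE; suff -> : Q.[s l] = 0 by rewrite mulr0 mul0r.
rewrite horner_prod; apply/eqP/prodf_eq0.
have [l'|->] := unliftP j' l.
  by move=> ->; exists l' => //; rewrite !hornerE subrr.
have ij' : j' != Ordinal ik by rewrite -val_eqE /= gtn_eqF.
have [i' i'E _] := unlift_some ij'.
exists i' => //; rewrite !hornerE -i'E /= sij subrr //.
Qed.

End Path.

(** The eigenvalues [c + t * s i] of [A = c + t B] lie within [del] of [c], where
    [G k] is negative, and [g(A)] is the value at [A] of a polynomial of degree
    [k] with leading coefficient [G k xi / k!]. *)
Lemma neg_deriv_not_preserves_DN (R : realType) (g : R -> R) (G : nat -> R -> R) k c :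
  (forall t, 0 < t -> G 0%N t = g t) ->
  (forall i (t : R), 0 < t -> is_derive t 1 (G i) (G i.+1 t)) ->
  0 < c -> G k c < 0 -> ~ preserves_DN k.+1 g.
Proof.
move=> G0 dG c0 Gc gDN.
have [del del0 Gdel] : exists2 del, 0 < del & forall y, `|c - y| < del -> G k y < 0.
  have dGc := dG k c c0.
  have /derivable1_diffP/differentiable_continuous Gcont : derivable (G k) c 1.
    exact: ex_derive.
  have : \forall y \near c, G k y < 0 by exact: (cvgr_lt (G k c) Gcont).
  by move=> /nbhs_ballP[del /= del0 Bdel]; exists del => // y yc; exact: Bdel.
have [U [s [UU BE sdec]]] := path_mx_spectrum R k.
(* An upper bound for the eigenvalues of the path, so that t keeps those of A
   positive and within del of c. *)
pose S := 1 + \sum_(i < k.+1) `|s i|.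
have S0 : 0 < S by rewrite ltr_wpDr // sumr_ge0.
have sS i : (i <= k)%N -> `|s i| < S.
  move=> ik; rewrite /S (bigD1 (Ordinal (ik : (i < k.+1)%N))) //= addrCA ltrDl.
  by rewrite ltr_wpDr // sumr_ge0.
pose t := Num.min del c / S.
have t0 : 0 < t by rewrite divr_gt0 // lt_min del0.
have ts i : (i <= k)%N -> `|t * s i| < Num.min del c.
  move=> ik; rewrite normrM (gtr0_norm t0) /t -mulrA gtr_pMr ?lt_min ?del0 //.
  by rewrite mulrC ltr_pdivrMr // mul1r sS.
pose d : 'rV[R]_k.+1 := \row_i (c + t * s i).
pose A := U *m diag_mx d *m U^T.
have AE : A = c%:M + t *: path_mx R k.
  have -> : A = c *: (U *m U^T) + t *: (U *m diag_mx (\row_i s i) *m U^T).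
    rewrite /A; have -> : diag_mx d = c%:M + t *: diag_mx (\row_i s i).
      apply/matrixP => i j; rewrite !mxE.
      by case: eqP => _; rewrite ?mulr1n ?mulr0n ?mulr0 ?addr0.
    by rewrite mulmxDr mulmxDl -scalemxAr -scalemxAl mul_mx_scalar -scalemxAl.
  by rewrite UU -BE scalemx1.
have d_gt0 i : (i <= k)%N -> 0 < c + t * s i.
  move=> ik; have := ts i ik; rewrite lt_min => /andP[_]; rewrite ltr_norml => /andP[+ _].
  by rewrite -subr_gt0 opprK addrC.
have ADN : doubly_nonneg A.
  split.
    by apply: orth_diag_psd => // i; rewrite mxE ltW // d_gt0 // -ltnS.
  move=> i j; rewrite AE !mxE; apply: addr_ge0.
    by case: eqP => _; rewrite ?mulr1n ?mulr0n // ltW.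
  by apply: mulr_ge0; [exact: ltW|exact: ler0n].
pose x i := c + t * s (k - i)%N.
have x_lt : forall i j, (i < j <= k)%N -> x i < x j.
  by move=> i j /andP[ij jk]; rewrite ltrD2l ltr_pM2l // sdec //; lia.
have x0_gt0 : 0 < x 0%N by apply: d_gt0; rewrite subn0.
have [xi [x0xi xixk Gxi]] := divided_diff_mean (g := g) (k := k) G0 dG x0_gt0 x_lt.
have dd0 : divided_diff g x k < 0.
  have : divided_diff g x k * k`!%:R < 0.
    rewrite -Gxi Gdel //.
    have := ts k (leqnn k); have := ts 0%N (leq0n k); rewrite !lt_min => /andP[+ _] /andP[+ _].
    rewrite /x subn0 subnn in x0xi xixk.
    by rewrite !ltr_norml => /andP[? ?] /andP[? ?]; apply/andP; split; lra.
  by rewrite pmulr_llt0 // ltr0n fact_gt0.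
pose P := newton_interp g x k.+1.
have gA : mxfun g A = horner_mx A P.
  rewrite (mxfunE g (U := U) (d := d)); last by split.
  rewrite /A horner_mx_orth_diag //; congr (_ *m diag_mx _ *m _).
  apply/rowP => i; rewrite !mxE.
  have ik : (i <= k)%N by rewrite -ltnS.
  have -> : c + t * s i = x (k - i)%N by rewrite /x subKn.
  rewrite newton_interp_node //; last by rewrite ltnS leq_subr.
  by move=> a b /andP[ab bk]; rewrite lt_eqF // x_lt // ab -ltnS.
have [_ /(_ 0 ord_max)] := gDN A ADN; rewrite gA (@hessenberg_horner _ _ _ t).
- by rewrite coef_newton_interp leNgt pmulr_llt0 ?exprn_gt0 // dd0.
- move=> i j ij; rewrite AE !mxE; case: eqP => [ijE|_]; first by rewrite ijE in ij; lia.
  by case: eqP => [?|_]; [lia|case: eqP => [?|_]; [lia|rewrite mulr0n mulr0 addr0]].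
- move=> i j ij; rewrite AE !mxE ij eqxx /= mulr1.
  by case: eqP => [ijE|_]; [rewrite ijE in ij; lia|rewrite mulr0n add0r].
- exact: size_newton_interp.
Qed.

(** * The critical exponent *)

Lemma mxfunM (R : realType) n (h k : R -> R) (A : 'M[R]_n) : A^T = A ->
  mxfun h A *m mxfun k A = mxfun (fun x => h x * k x) A.
Proof.
move=> /orth_diag[U [d [UU AE]]]; rewrite !(mxfunE _ (conj UU AE)) /=.
rewrite !mulmxA -(mulmxA _ U^T) (mulmx1C UU) mulmx1 -(mulmxA U (diag_mx _)).
rewrite mulmx_diag; congr (_ *m diag_mx _ *m _).
by apply/rowP => i; rewrite !mxE.
Qed.

Lemma powR_prod_preserves (R : realType) n (u alpha beta : R) (A : 'M[R]_n) :
  (2 <= n)%N -> 0 < u -> n%:R - 2 + Num.max beta 0 <= alpha -> doubly_nonneg A ->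
  doubly_nonneg (mxfun (fun x => x `^ alpha) A *m mxfun (fun x => (x + u) `^ (- beta)) A).
Proof.
case: n A => [|[|n]] // A _ u0 alpha_ge [Apsd A0].
have n0 : 0 <= n%:R :> R by exact: ler0n.
have b0 : 0 <= Num.max beta 0 by rewrite le_max lexx orbT.
have bmax : beta <= Num.max beta 0 by rewrite le_max lexx.
have alpha0 : n%:R <= alpha by rewrite -!natr1 in alpha_ge; lra.
have alphab : n%:R <= alpha - beta by rewrite -!natr1 in alpha_ge; lra.
have [U [s [UU AE sdec]]] := orth_diag_sorted Apsd.1.
have s0 i : (i <= n.+1)%N -> 0 <= s i.
  move=> i_n; have := Apsd; rewrite AE => /(psd_orth_diag (Ordinal (i_n : (i < n.+2)%N)) UU).
  by rewrite mxE.
pose g x := x `^ alpha * (x + u) `^ (- beta).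
rewrite (mxfunM _ _ Apsd.1) (mxfunE _ (conj UU AE)) /=.
rewrite -/g.
have -> : map_mx g (\row_(k < n.+2) s k) = \row_(k < n.+2) g (s k).
  by apply/rowP => k; rewrite !mxE.
split; first by apply: orth_diag_psd => // k; rewrite mxE mulr_ge0 ?powR_ge0.
move=> a b; apply: (orth_diag_map_ge0 (A := A)) => //.
- move=> x x0 xlt k kn.
  have x_lt i j : (i < j <= k)%N -> x i < x j.
    by case/andP=> ij jk; apply: xlt; rewrite ij (leq_trans jk).
  have [||xi [_ _ dd]] := @divided_diff_mean R g x (iter_deriv alpha (- beta) u) k _ _ x0 x_lt.
  + by move=> t _; exact: iter_deriv0.
  + by move=> i t; exact: is_derive_iter_deriv.
  have : 0 <= divided_diff g x k * k`!%:R.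
    have kn1 : k%:R - 1 <= n%:R :> R by rewrite lerBlDr natr1 ler_nat.
    by rewrite -dd iter_deriv_ge0 // (le_trans kn1).
  by rewrite pmulr_lge0 // ltr0n fact_gt0.
- move=> l c l0 c0; apply: powR_prod_cvg_right => //; lra.
Qed.

(** Take [k = j + 1] with [j] the least natural number above [z]: only the last
    factor [z - j] of the falling factorial is negative. *)
Lemma falling_lt0 (R : realType) (z : R) n : (2 <= n)%N ->
  z < n%:R - 2 -> (forall m, (m < n - 2)%N -> z != m%:R) ->
  exists2 k, (0 < k < n)%N & falling z k < 0.
Proof.
move=> n2 zn zm; rewrite -natrB // in zn.
have [j zj jmin] := ex_minnP (ex_intro (fun j : nat => z < j%:R) (n - 2)%N zn).
have jn : (j <= n - 2)%N by exact: jmin.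
exists j.+1; first by lia.
rewrite fallingS pmulr_rlt0 ?subr_lt0 //; apply: prodr_gt0 => i _.
have ij := ltn_ord i; rewrite subr_gt0 lt_neqAle eq_sym zm /=; last exact: leq_trans jn.
by rewrite leNgt; apply/negP => /jmin; rewrite leqNgt ij.
Qed.

Lemma powR_prod_not_preserves (R : realType) n (u alpha beta : R) :
  (2 <= n)%N -> 0 < u -> alpha - Num.max beta 0 < n%:R - 2 ->
  (forall m, (m < n - 2)%N -> alpha - Num.max beta 0 != m%:R) ->
  ~ preserves_DN n (fun x => x `^ alpha * (x + u) `^ (- beta)).
Proof.
move=> n2 u0 zn zm; have [k /andP[k0 kn] fk] := falling_lt0 n2 zn zm.
have [c c0 Gc] : exists2 c, 0 < c & iter_deriv alpha (- beta) u k c < 0.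
  case: (leP beta 0) fk => b0; last exact: iter_deriv_lt0_nearoo.
  by rewrite subr0; exact: iter_deriv_lt0_near0.
rewrite -(subnKC kn) => /preserves_DN_sub.
apply: (neg_deriv_not_preserves_DN (G := iter_deriv alpha (- beta) u)) c0 Gc.
  by move=> t _; exact: iter_deriv0.
by move=> i t; exact: is_derive_iter_deriv.
Qed.

Theorem theorem1p6 (R : realType) (n : nat) (u beta : R) :
  (2 <= n)%N -> 0 < u ->
  let f := fun x : R => (x + u) `^ (- beta) in
  let exceptional := [set alpha : R |
    [/\ 0 <= alpha, (alpha%:E < critical_exponent f n)%E &
        preserves_DN n (fun x : R => x `^ alpha * (x + u) `^ (- beta))]] in
  [/\ critical_exponent f n = (n%:R - 2 + Num.max beta 0)%:E,
      finite_set exceptional &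
      exceptional `<=` [set m%:R + Num.max beta 0 | m in `I_(n - 2)]].
Proof.
move=> n2 u0 f exceptional; set M := n%:R - 2 + Num.max beta 0.
have b0 : 0 <= Num.max beta 0 by rewrite le_max lexx orbT.
have n2R : 2 <= n%:R :> R by rewrite (ler_nat R 2).
have critE : critical_exponent f n = M%:E.
  apply/eqP; rewrite eq_le; apply/andP; split.
    apply: ereal_inf_lbound; exists M => //; split; first by rewrite /M; lra.
    by move=> A alpha ADN Malpha; exact: powR_prod_preserves.
  apply: le_ereal_inf_tmp => _ [t [t0 tP] <-]; rewrite lee_fin leNgt; apply/negP => tM.
  (* An exponent between t and M whose offset lies strictly between n - 3 and
     n - 2, so that it is not one of the exceptional values. *)
  pose alpha := (Num.max t (M - 1) + M) / 2.
  have [mt mM] : t <= Num.max t (M - 1) /\ M - 1 <= Num.max t (M - 1).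
    by rewrite !le_max !lexx orbT.
  have mltM : Num.max t (M - 1) < M by rewrite gt_max tM /=; lra.
  have ta : t <= alpha by rewrite /alpha; lra.
  apply: (@powR_prod_not_preserves R n u alpha beta n2 u0).
  - by rewrite /alpha; rewrite -/M /M in mltM *; lra.
  - move=> m mn; apply/negP => /eqP E.
    have : m%:R + 1 <= n%:R - 2 :> R by rewrite -natrB // natr1 ler_nat.
    by move: E; rewrite /alpha; move: mM; rewrite /M; lra.
  - by move=> A ADN; rewrite -(mxfunM _ _ ADN.1.1); exact: tP.
have sub : exceptional `<=` [set m%:R + Num.max beta 0 | m in `I_(n - 2)].
  move=> alpha [_]; rewrite critE lte_fin => aM gDN.
  apply: contrapT => notin.
  apply: (@powR_prod_not_preserves R n u alpha beta n2 u0) gDN.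
    by rewrite /M in aM; lra.
  move=> m mn; apply/negP => /eqP E; apply: notin; exists m => //.
  by rewrite -E subrK.
split => //; apply: sub_finite_set sub _.
by apply: finite_image; exact: finite_II.
Qed.
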